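(* Let $\mathbb{F}$ be a field of characteristic different from $3$ and let $A=A_0\oplus A_1$ be a graded-nil finite dimensional alternative superalgebra over $\mathbb{F}$. If every $a_1\in A_1$ is nilpotent of index $2$ (that is, $a_1^2=0$ for all $a_1\in A_1$), then $A$ is nilpotent.
   Context: Algebras are not assumed associative or unital. The associator is $(x,y,z)=(xy)z-x(yz)$; an algebra is alternative if $(x,x,y)=0$ and $(x,y,y)=0$ hold identically. A superalgebra over $\mathbb{F}$ is an algebra $A=A_0\oplus A_1$ with subspaces $A_0,A_1$ such that $A_iA_j\subseteq A_{i+j \bmod 2}$. Elements of $A_0\cup A_1$ are homogeneous; for nonzero homogeneous $x$, $|x|=0$ if $x\in A_0$ (even) and $|x|=1$ if $x\in A_1$ (odd). Let $G=G_0\oplus G_1$ be the Grassmann algebra over $\mathbb{F}$: the unital associative algebra generated by $e_1,e_2,\dots$ with $e_ie_j=-e_je_i$ and $e_i^2=0$, where $G_0$ is spanned by $1$ and the products of an even number of $e_i$'s and $G_1$ is spanned by the products of an odd number of $e_i$'s. The Grassmann envelope of $A$ is $G(A)=G_0\otimes A_0\oplus G_1\otimes A_1$ with product $(x\otimes u)(y\otimes v)=xy\otimes uv$. The superalgebra $A$ is called an alternative superalgebra if $G(A)$ is an alternative algebra. Such an $A$ satisfies, for all nonzero homogeneous $x,y,z$ and all $a\in A_0$: $(x,y,z)+(-1)^{|y||z|}(x,z,y)=0$, $(x,y,z)+(-1)^{|x||y|}(y,x,z)=0$, and $(a,a,x)=0$. A superalgebra is graded-nil if every homogeneous element is nilpotent,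 i.e. some power of it is zero. (The even part $A_0$ is an alternative algebra, so powers of even elements are unambiguous.) An algebra is nilpotent if there is a positive integer $n$ such that every product of $n$ of its elements, with any arrangement of parentheses, is zero. *)

(* Defs.v *)
From mathcomp Require Import all_boot all_algebra.
From mathcomp Require Import finmap.
From mathcomp Require Import monalg.

Set Implicit Arguments.
Unset Strict Implicit.
Unset Printing Implicit Defensive.

Import GRing.Theory.
Local Open Scope fset_scope.
Local Open Scope ring_scope.

(* An algebra, not assumed associative or unital, is a vector space together   *)
(* with a bilinear product [mul]; it is finite dimensional when the carrier    *)
(* is a [vectType].                                                            *)

Definition associator (A : zmodType) (mul : A -> A -> A) (x y z : A) : A :=
  mul (mul x y) z - mul x (mul y z).

(* [B] is the carrier of a subalgebra; the two laws are required inside [B].   *)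
Definition alternative_on (A : zmodType) (mul : A -> A -> A) (B : A -> Prop) :=
  forall x y, B x -> B y ->
    associator mul x x y = 0 /\ associator mul x y y = 0.

(* Products of finitely many elements, with an arbitrary arrangement of        *)
(* parentheses: the leaves, from left to right, are the factors.               *)
Inductive bracketing (A : Type) : Type :=
| Factor of A
| Product of bracketing A & bracketing A.

Fixpoint nb_factors (A : Type) (t : bracketing A) : nat :=
  match t with
  | Factor _ => 1
  | Product t1 t2 => nb_factors t1 + nb_factors t2
  end.

Fixpoint bracketing_eval (A : Type) (mul : A -> A -> A) (t : bracketing A) : A :=
  match t with
  | Factor x => x
  | Product t1 t2 => mul (bracketing_eval mul t1) (bracketing_eval mul t2)
  end.

Definition nilpotent_algebra (A : zmodType) (mul : A -> A -> A) : Prop :=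
  exists2 n : nat, (0 < n)%N &
    forall t : bracketing A, nb_factors t = n -> bracketing_eval mul t = 0.

(* [alg_power mul x n] is the left-normed power x^(n+1) = (..(x x)..) x;       *)
(* there is no x^0 since the algebra need not have a unit.                     *)
Definition alg_power (A : Type) (mul : A -> A -> A) (x : A) (n : nat) : A :=
  iter n (fun y => mul y x) x.

Definition nilpotent_element (A : zmodType) (mul : A -> A -> A) (x : A) : Prop :=
  exists n : nat, alg_power mul x n = 0.

Section Superalgebra.
Variables (F : fieldType) (A : vectType F).
Variables (mul : A -> A -> A) (gr : bool -> {vspace A}).

(* [gr false] is the even part A_0 and [gr true] the odd part A_1, so that     *)
(* addition of degrees modulo 2 is the exclusive or [(+)].                     *)
Definition superalgebra : Prop :=
  [/\ directv (gr false + gr true),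
      (gr false + gr true)%VS = fullv
    & forall (i j : bool) (x y : A),
        x \in gr i -> y \in gr j -> mul x y \in gr (i (+) j)].

Definition homogeneous (x : A) : Prop := exists i : bool, x \in gr i.

Definition graded_nil : Prop :=
  forall x : A, homogeneous x -> nilpotent_element mul x.

End Superalgebra.

(* The Grassmann algebra G on the generators e_0, e_1, ... has the basis of    *)
(* ordered monomials e_S = e_{s_1} ... e_{s_k}, for S = {s_1 < ... < s_k} a    *)
(* finite set of indices, so it is represented by the finitely supported       *)
(* functions [{malg F[{fset nat}]}], with [<< c *g S >>] standing for c e_S.   *)
(* Sorting e_S e_T takes one transposition for each pair (s, t) in S x T with  *)
(* t < s, and e_S e_T = 0 as soon as S and T share an index.                   *)
Definition grassmann_inv (S T : {fset nat}) : nat :=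
  \sum_(s <- S) \sum_(t <- T) (t < s)%N.

Definition grassmann_coef (F : fieldType) (S T : {fset nat}) : F :=
  if [disjoint S & T]%fset then (-1) ^+ grassmann_inv S T else 0.

Section Grassmann.
Variable F : fieldType.

Definition grassmann_mul (x y : {malg F[{fset nat}]}) : {malg F[{fset nat}]} :=
  \sum_(S <- msupp x) \sum_(T <- msupp y)
    << grassmann_coef F S T * (x@_S * y@_T) *g (S `|` T) >>.

Definition grassmann_gen (i : nat) : {malg F[{fset nat}]} := << [fset i] >>.

(* Since the e_S form a basis of G, an element of the tensor product of G and  *)
(* A is uniquely a finite sum of terms e_S (x) a_S with a_S in A; it is        *)
(* represented by the finitely supported function S |-> a_S.                   *)
Variables (A : lmodType F) (mul : A -> A -> A).

Definition gtensor (x : {malg F[{fset nat}]}) (a : A) : {malg A[{fset nat}]} :=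
  \sum_(S <- msupp x) << x@_S *: a *g S >>.

Definition gtensor_mul (f g : {malg A[{fset nat}]}) : {malg A[{fset nat}]} :=
  \sum_(S <- msupp f) \sum_(T <- msupp g)
    << grassmann_coef F S T *: mul f@_S g@_T *g (S `|` T) >>.

End Grassmann.

Section Envelope.
Variables (F : fieldType) (A : vectType F).
Variables (mul : A -> A -> A) (gr : bool -> {vspace A}).

(* G_0 (resp. G_1) is spanned by the e_S with #|S| even (resp. odd).           *)
Definition grassmann_envelope (f : {malg A[{fset nat}]}) : Prop :=
  forall S : {fset nat}, f@_S \in gr (odd #|` S|).

Definition alternative_superalgebra : Prop :=
  superalgebra mul gr /\ alternative_on (gtensor_mul mul) grassmann_envelope.

End Envelope.


Section GrassmannTheory.
Variable F : fieldType.
Implicit Types S T U : {fset nat}.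

Lemma grassmann_coefA S T U :
  grassmann_coef F S T * grassmann_coef F (S `|` T) U =
  grassmann_coef F T U * grassmann_coef F S (T `|` U).
Proof.
rewrite /grassmann_coef fdisjointUX fdisjointXU.
case: ifP => dST; case: (boolP [disjoint S & U]%fset) => dSU;
case: (boolP [disjoint T & U]%fset) => dTU; rewrite ?mul0r ?mulr0 //=.
rewrite -!exprD /grassmann_inv; congr (_ ^+ _).
have split_ (X Y : {fset nat}) (f : nat -> nat) : [disjoint X & Y]%fset ->
   (\sum_(s <- X `|` Y) f s = \sum_(s <- X) f s + \sum_(s <- Y) f s)%N.
  move=> d; rewrite -big_cat; apply/perm_big/uniq_perm.
  - exact: fset_uniq.
  - rewrite cat_uniq !fset_uniq andbT /=; apply/hasPn => y yY.
    by apply/negP => yX; move/fdisjointP: d => /(_ _ yX); rewrite yY.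
  - by move=> y; rewrite mem_cat in_fsetU.
rewrite (split_ S T) //.
rewrite [X in _ = (_ + X)%N](eq_bigr _ (fun s _ => split_ T U _ dTU)).
by rewrite big_split /= addnA [RHS]addnC.
Qed.

Section GtensorTheory.

Variables (A : lmodType F) (mul : {bilinear A -> A -> A}).
Local Notation gm := (gtensor_mul mul).

Lemma gtensor_mulw (d1 d2 : {fset {fset nat}}) f g :
  msupp f `<=` d1 -> msupp g `<=` d2 ->
  gm f g = \sum_(S <- d1) \sum_(T <- d2)
    << grassmann_coef F S T *: mul f@_S g@_T *g (S `|` T) >>.
Proof.
move=> le1 le2; rewrite /gtensor_mul (big_fset_incl _ le1) /=.
  apply/eq_bigr=> k1 _; apply/big_fset_incl => // k _ /mcoeff_outdom ->.
  by rewrite linear0r scaler0 monalgU0.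
move=> k _ /mcoeff_outdom g1k.
by rewrite big1 => // k' _; rewrite g1k linear0l scaler0 monalgU0.
Qed.

Lemma gtensor_mulUU S T u v :
  gm << u *g S >> << v *g T >> =
  << grassmann_coef F S T *: mul u v *g S `|` T >>.
Proof. by rewrite (gtensor_mulw msuppU_le msuppU_le) !big_seq_fset1 !mcoeffUU. Qed.

Lemma gtensor_mulDl f f' g : gm (f + f') g = gm f g + gm f' g.
Proof.
set d := msupp f `|` msupp f'; set e := msupp g.
rewrite !(@gtensor_mulw d e) ?msuppD_le ?fsubsetUl ?fsubsetUr ?fsubset_refl //.
rewrite -big_split; apply: eq_bigr => S _.
rewrite -big_split; apply: eq_bigr => T _ /=.
by rewrite mcoeffD linearDl scalerDr monalgUD.
Qed.

Lemma gtensor_mulDr f g g' : gm f (g + g') = gm f g + gm f g'.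
Proof.
set d := msupp g `|` msupp g'; set e := msupp f.
rewrite !(@gtensor_mulw e d) ?msuppD_le ?fsubsetUl ?fsubsetUr ?fsubset_refl //.
rewrite -big_split; apply: eq_bigr => S _.
rewrite -big_split; apply: eq_bigr => T _ /=.
by rewrite mcoeffD linearDr scalerDr monalgUD.
Qed.

Lemma gtensor_mul0l g : gm 0 g = 0.
Proof. by rewrite /gtensor_mul msupp0 big_seq_fset0. Qed.

Lemma gtensor_mul0r g : gm g 0 = 0.
Proof. by rewrite /gtensor_mul big1 // => S _; rewrite msupp0 big_seq_fset0. Qed.

Lemma gtensorw (d : {fset {fset nat}}) x (a : A) : msupp x `<=` d ->
  gtensor x a = \sum_(S <- d) << x@_S *: a *g S >>.
Proof.
move=> le; apply: big_fset_incl => // k _ /mcoeff_outdom ->.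
by rewrite scale0r monalgU0.
Qed.

Lemma gtensorU S c (a : A) : gtensor << c *g S >> a = << c *: a *g S >>.
Proof. by rewrite (gtensorw _ msuppU_le) big_seq_fset1 mcoeffUU. Qed.

Lemma gtensorDl x y (a : A) : gtensor (x + y) a = gtensor x a + gtensor y a.
Proof.
rewrite !(@gtensorw (msupp x `|` msupp y)) ?msuppD_le ?fsubsetUl ?fsubsetUr //.
by rewrite -big_split; apply: eq_bigr => S _; rewrite mcoeffD scalerDl monalgUD.
Qed.

Lemma gtensorDr x (a b : A) : gtensor x (a + b) = gtensor x a + gtensor x b.
Proof. by rewrite -big_split; apply: eq_bigr => S _; rewrite scalerDr monalgUD. Qed.

Lemma gtensor0 (a : A) : gtensor 0 a = 0.
Proof. by rewrite /gtensor msupp0 big_seq_fset0. Qed.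

Lemma gtensor_sum I (r : seq I) (f : I -> {malg F[{fset nat}]}) (a : A) :
  gtensor (\sum_(i <- r) f i) a = \sum_(i <- r) gtensor (f i) a.
Proof.
by elim/big_rec2: _ => [|i y1 y2 _ <-]; rewrite ?gtensor0 ?gtensorDl.
Qed.

Lemma gtensor_mul_suml I (r : seq I) f g :
  gm (\sum_(i <- r) f i) g = \sum_(i <- r) gm (f i) g.
Proof.
by elim/big_rec2: _ => [|i y1 y2 _ <-]; rewrite ?gtensor_mul0l ?gtensor_mulDl.
Qed.

Lemma gtensor_mul_sumr I (r : seq I) f g :
  gm g (\sum_(i <- r) f i) = \sum_(i <- r) gm g (f i).
Proof.
by elim/big_rec2: _ => [|i y1 y2 _ <-]; rewrite ?gtensor_mul0r ?gtensor_mulDr.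
Qed.

Lemma gtensorM x y a b :
  gm (gtensor x a) (gtensor y b) = gtensor (grassmann_mul x y) (mul a b).
Proof.
rewrite /grassmann_mul gtensor_sum {1}/gtensor gtensor_mul_suml.
apply: eq_bigr => S _.
rewrite gtensor_sum /gtensor gtensor_mul_sumr.
apply: eq_bigr => T _.
by rewrite -/(gtensor _ _) gtensorU gtensor_mulUU
  linearZl_LR linearZr_LR /= !scalerA.
Qed.

Lemma gtensor_span (f : {malg A[{fset nat}]}) :
  f = \sum_(S <- msupp f) gtensor << S >> f@_S.
Proof. by rewrite {1}[f]monalgE; apply: eq_bigr => S _; rewrite gtensorU scale1r. Qed.

End GtensorTheory.

Lemma grassmann_coef0l S : grassmann_coef F fset0 S = 1.
Proof. by rewrite /grassmann_coef fdisjoint0X /grassmann_inv big_seq_fset0. Qed.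

Lemma grassmann_coef0r S : grassmann_coef F S fset0 = 1.
Proof.
rewrite /grassmann_coef fdisjointX0 /grassmann_inv big1 // => i _.
by rewrite big_seq_fset0.
Qed.

Lemma grassmann_mulUU S T u v :
  grassmann_mul << u *g S >> << v *g T >> =
  << grassmann_coef F S T * (u * v) *g S `|` T >> :> {malg F[{fset nat}]}.
Proof.
rewrite /grassmann_mul !msuppU.
case: eqP => [->|_]; first by rewrite big_seq_fset0 mul0r mulr0 monalgU0.
case: eqP => [->|_]; first by rewrite big_seq_fset1 big_seq_fset0 !mulr0 monalgU0.
by rewrite !big_seq_fset1 !mcoeffUU.
Qed.

Lemma grassmann_gen_sqr i :
  grassmann_mul (grassmann_gen F i) (grassmann_gen F i) = 0.
Proof.
by rewrite grassmann_mulUU /grassmann_coef fdisjointX1 in_fset1 eqxx mul0r monalgU0.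
Qed.

Lemma grassmann_genC i j :
  grassmann_mul (grassmann_gen F i) (grassmann_gen F j) =
  - grassmann_mul (grassmann_gen F j) (grassmann_gen F i).
Proof.
have [->|nij] := eqVneq i j; first by rewrite grassmann_gen_sqr oppr0.
rewrite !grassmann_mulUU /grassmann_coef !fdisjointX1 !in_fset1.
rewrite [j == i]eq_sym (negPf nij) /=.
rewrite /grassmann_inv !big_seq_fset1 -monalgUN fsetUC !mulr1; congr << _ *g _ >>.
by case: ltngtP nij => //=; rewrite ?expr1 ?expr0 ?opprK.
Qed.

Lemma grassmann_gen_ordered i S : (forall j, j \in S -> (i < j)%N) ->
  grassmann_mul (grassmann_gen F i) << S >> = << i |` S >>.
Proof.
move=> lt; rewrite grassmann_mulUU /grassmann_coef fdisjoint1X ifT; last first.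
  by apply/negP => /lt; rewrite ltnn.
rewrite /grassmann_inv big_seq_fset1 big_seq big1 ?mulr1 ?expr0 // => j /lt ij.
by rewrite ltnNge ltnW.
Qed.

End GrassmannTheory.

Lemma grassmann_envelopeM (F : fieldType) (A : vectType F)
    (mul : {bilinear A -> A -> A}) gr (f g : {malg A[{fset nat}]}) :
  superalgebra mul gr ->
  grassmann_envelope gr f -> grassmann_envelope gr g ->
  grassmann_envelope gr (gtensor_mul mul f g).
Proof.
case=> _ _ cl hf hg U; rewrite /gtensor_mul raddf_sum rpred_sum // => S _.
rewrite raddf_sum rpred_sum // => T _ /=; rewrite mcoeffU.
case: eqP => [<-|_]; last by rewrite mulr0n mem0v.
rewrite mulr1n /grassmann_coef; case: ifP => [d|_]; last by rewrite scale0r mem0v.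
apply: rpredZ; suff -> : odd #|` S `|` T| = odd #|` S| (+) odd #|` T| by exact: cl.
by rewrite cardfsU (eqP (_ : S `&` T == fset0)) ?cardfs0 ?subn0 ?oddD.
Qed.

(* Main.v *)
Require Import Defs.
From mathcomp Require Import all_boot all_algebra.
From mathcomp Require Import finmap monalg.
From Stdlib Require Import Classical.

Import GRing.Theory.
Local Open Scope ring_scope.

(* If every odd x has x^2 = 0, odd elements anticommute, and the super-        *)
(* alternative laws for x, x, a with x odd become 2p + q = p + 2q = 0; as the  *)
(* characteristic is not 3, p = q = 0.  Hence (x,x,a), (x,a,x) and (a,x,x)     *)
(* vanish for all homogeneous x and a, and the classical argument for finite   *)
(* dimensional alternative nil algebras applies: a graded subalgebra B <> A    *)
(* whose multiplications generate a nilpotent algebra of operators on A is     *)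
(* normalized by some homogeneous x outside B, which nilpotency of x lets one  *)
(* choose with x^2 in B, and the same nilpotency then holds for B + Fx.        *)

(** The induction is carried by [killed]: for some [n], any [n] left or right multiplications by
    homogeneous elements of [B] annihilate every homogeneous element of [A]. For [B = 0], [n = 1]
    works. If [B] is not yet all of [A], multiplying an outside element by [B] while the result
    stays outside must stop, at a normalizing element ([exists_normalizes]); repeated squaring makes
    its square fall in [B] ([exists_normalizes_sqr]); adjoining it replaces [n] by [3 * n]
    ([killed_adjoin]). Dimension bounds the number of extensions ([homogeneous_killed_gr]). Finally,
    a product of [2 ^ n] factors contains [n] nested multiplications, so it vanishes
    ([nilpotent_algebra_killed]). The identities used come from the Grassmann envelope
    ([super_swapl], [super_swapr]) and from [homogeneous_alternative], where the characteristic and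
    the vanishing odd squares enter. *)

Section BiadditiveAssociator.
Set Implicit Arguments.
Unset Strict Implicit.
Variables (Z : zmodType) (m : Z -> Z -> Z).
Hypothesis mDl : forall x y z, m (x + y) z = m x z + m y z.
Hypothesis mDr : forall x y z, m x (y + z) = m x y + m x z.
Local Notation assoc := (associator m).

Lemma associatorDl f f' g h : assoc (f + f') g h = assoc f g h + assoc f' g h.
Proof. by rewrite /associator !mDl opprD addrACA. Qed.

Lemma associatorDm f g g' h : assoc f (g + g') h = assoc f g h + assoc f g' h.
Proof. by rewrite /associator mDr !mDl mDr opprD addrACA. Qed.

Lemma associatorDr f g h h' : assoc f g (h + h') = assoc f g h + assoc f g h'.
Proof. by rewrite /associator !mDr opprD addrACA. Qed.

Lemma associator_swapl f g h : assoc f f h = 0 -> assoc g g h = 0 ->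
  assoc (f + g) (f + g) h = 0 -> assoc f g h + assoc g f h = 0.
Proof. by move=> ef eg; rewrite associatorDl !associatorDm ef eg add0r addr0. Qed.

Lemma associator_swapr f g h : assoc f g g = 0 -> assoc f h h = 0 ->
  assoc f (g + h) (g + h) = 0 -> assoc f g h + assoc f h g = 0.
Proof. by move=> eg eh; rewrite associatorDm !associatorDr eg eh add0r addr0. Qed.

End BiadditiveAssociator.

(** * Signs of products of Grassmann monomials *)

Section GrassmannSigns.
Variable F : fieldType.

Lemma grassmann_coef_lt (S T : {fset nat}) :
  (forall s t, s \in S -> t \in T -> (s < t)%N) -> grassmann_coef F S T = 1.
Proof.
move=> lt; rewrite /grassmann_coef ifT; last first.
  by apply/fdisjointP => s sS; apply/negP => /(lt _ _ sS); rewrite ltnn.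
rewrite /grassmann_inv big_seq big1 // => s sS.
by rewrite big_seq big1 // => t tT; rewrite ltnNge ltnW // lt.
Qed.

(** Index set of a monomial to pair with an element of degree [i]: a generator if odd, the unit if
    even. This treats all parities at once. *)
Definition odd_set (i : bool) (p : nat) : {fset nat} :=
  if i then [fset p]%fset else fset0.

Lemma in_odd_set i p s : (s \in odd_set i p) = i && (s == p).
Proof. by case: i; rewrite /odd_set ?in_fset1 ?in_fset0. Qed.

Lemma odd_card_odd_set i p : odd #|` odd_set i p| = i.
Proof. by case: i; rewrite /odd_set ?cardfs1 ?cardfs0. Qed.

Lemma grassmann_coef_odd_set i j p q : (p < q)%N ->
  grassmann_coef F (odd_set j q) (odd_set i p) = (-1) ^+ (i && j).
Proof.
move=> pq; case: i; case: j; rewrite /= ?grassmann_coef0l ?grassmann_coef0r //.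
rewrite /grassmann_coef fdisjointX1 in_fset1 (ltn_eqF pq).
by rewrite /grassmann_inv !big_seq_fset1 pq.
Qed.

End GrassmannSigns.

(** * From the Grassmann envelope to identities between homogeneous elements *)

Section AlternativeSuperalgebra.
Set Implicit Arguments.
Unset Strict Implicit.
Variables (F : fieldType) (A : vectType F).
Variables (mul : {bilinear A -> A -> A}) (gr : bool -> {vspace A}).
Hypothesis A_alternative : alternative_superalgebra mul gr.

Local Notation "x ** y" := (mul x y) (at level 40, left associativity).
Local Notation assoc := (associator mul).
Local Notation gm := (gtensor_mul mul).

Lemma mul_homogeneous i j x y : x \in gr i -> y \in gr j -> x ** y \in gr (i (+) j).
Proof. by case: A_alternative => -[_ _ cl] _; apply: cl. Qed.

Lemma homogeneous_decomp x :
  exists y z, [/\ y \in gr false, z \in gr true & x = y + z].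
Proof.
case: A_alternative => -[_ full _] _; have: x \in fullv by rewrite memvf.
by rewrite -full => /memv_addP[y yE [z zO ->]]; exists y, z.
Qed.

Definition monomial S (x : A) : {malg A[{fset nat}]} := << x *g S >>.

Lemma monomial_envelope i p x :
  x \in gr i -> grassmann_envelope gr (monomial (odd_set i p) x).
Proof.
move=> xi U; rewrite mcoeffU; case: eqP => [<-|_]; last by rewrite mulr0n mem0v.
by rewrite mulr1n odd_card_odd_set.
Qed.

Lemma envelopeD f g : grassmann_envelope gr f -> grassmann_envelope gr g ->
  grassmann_envelope gr (f + g).
Proof. by move=> hf hg S; rewrite mcoeffD rpredD. Qed.

(** The Grassmann algebra is associative, so both bracketings carry the same sign, which factors
    out. *)
Lemma associator_monomial S T U x y z :
  associator gm (monomial S x) (monomial T y) (monomial U z) =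
  monomial (S `|` T `|` U)%fset
    ((grassmann_coef F S T * grassmann_coef F (S `|` T)%fset U) *: assoc x y z).
Proof.
rewrite /associator /monomial !gtensor_mulUU linearZl_LR linearZr_LR /= !scalerA.
rewrite fsetUA [grassmann_coef F S (_ `|` _)%fset * _]mulrC.
rewrite -grassmann_coefA [grassmann_coef F S T * _]mulrC.
by rewrite -monalgUB -scalerBr.
Qed.

Lemma envelope_swapl f g h :
  grassmann_envelope gr f -> grassmann_envelope gr g -> grassmann_envelope gr h ->
  associator gm f g h + associator gm g f h = 0.
Proof.
case: A_alternative => _ alt hf hg hh; apply: associator_swapl.
- exact: gtensor_mulDl.
- exact: gtensor_mulDr.
- exact: (alt _ _ hf hh).1.
- exact: (alt _ _ hg hh).1.
- exact: (alt _ _ (envelopeD hf hg) hh).1.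
Qed.

Lemma envelope_swapr f g h :
  grassmann_envelope gr f -> grassmann_envelope gr g -> grassmann_envelope gr h ->
  associator gm f g h + associator gm f h g = 0.
Proof.
case: A_alternative => _ alt hf hg hh; apply: associator_swapr.
- exact: gtensor_mulDl.
- exact: gtensor_mulDr.
- exact: (alt _ _ hf hg).2.
- exact: (alt _ _ hf hh).2.
- exact: (alt _ _ hf (envelopeD hg hh)).2.
Qed.

(** Pair the elements with monomials on the indices 0, 1, 2 and read off one coefficient: the only
    sign comes from exchanging the first two monomials. *)
Lemma super_swapl i j k x y z : x \in gr i -> y \in gr j -> z \in gr k ->
  assoc x y z + (-1) ^+ (i && j) *: assoc y x z = 0.
Proof.
move=> xi yj zk.
have := envelope_swapl (monomial_envelope 0 xi) (monomial_envelope 1 yj)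
  (monomial_envelope 2 zk).
rewrite !associator_monomial (@grassmann_coef_odd_set F i j 0 1) //.
rewrite [(odd_set j 1 `|` odd_set i 0)%fset]fsetUC.
rewrite !(grassmann_coef_lt, mulr1, scale1r); first last.
- by move=> s t; rewrite !in_odd_set => /andP[_ /eqP->] /andP[_ /eqP->].
- move=> s t; rewrite in_fsetU !in_odd_set.
  by move=> /orP[]/andP[_ /eqP->] /andP[_ /eqP->].
by move/(congr1 (mcoeff (odd_set i 0 `|` odd_set j 1 `|` odd_set k 2)%fset));
  rewrite mcoeffD mcoeff0 !mcoeffUU.
Qed.

Lemma super_swapr i j k x y z : x \in gr i -> y \in gr j -> z \in gr k ->
  assoc x y z + (-1) ^+ (j && k) *: assoc x z y = 0.
Proof.
move=> xi yj zk.
have := envelope_swapr (monomial_envelope 0 xi) (monomial_envelope 1 yj)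
  (monomial_envelope 2 zk).
(* Regrouping to the right isolates the sign of the last two monomials. *)
rewrite !associator_monomial !grassmann_coefA (@grassmann_coef_odd_set F j k 1 2) //.
rewrite [(odd_set k 2 `|` odd_set j 1)%fset]fsetUC.
rewrite [(_ `|` odd_set k 2 `|` odd_set j 1)%fset]fsetUAC.
rewrite !(grassmann_coef_lt, mulr1, scale1r); first last.
- by move=> s t; rewrite !in_odd_set => /andP[_ /eqP->] /andP[_ /eqP->].
- move=> s t; rewrite in_fsetU !in_odd_set.
  by move=> /andP[_ /eqP->] /orP[]/andP[_ /eqP->].
by move/(congr1 (mcoeff (odd_set i 0 `|` odd_set j 1 `|` odd_set k 2)%fset));
  rewrite mcoeffD mcoeff0 !mcoeffUU.
Qed.

Lemma even_alternative i a x : a \in gr false -> x \in gr i ->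
  assoc a a x = 0 /\ assoc x a a = 0.
Proof.
move=> aE xi; case: A_alternative => _ alt.
have eva := monomial_envelope 0 aE; have evx := monomial_envelope 0 xi.
have [l _] := alt _ _ eva evx; have [_ r] := alt _ _ evx eva.
split; [move: l | move: r]; rewrite associator_monomial !(fset0U, fsetU0);
  rewrite !(grassmann_coef0l, grassmann_coef0r) mulr1 scale1r;
  by move/(congr1 (mcoeff (odd_set i 0))); rewrite mcoeffUU mcoeff0.
Qed.

(** * Alternativity without signs on homogeneous elements *)

Section OddSquareZero.
Hypothesis char_neq3 : 3%N \notin [pchar F].
Hypothesis odd_sq0 : forall x, x \in gr true -> x ** x = 0.

Lemma odd_anticomm x y : x \in gr true -> y \in gr true -> x ** y = - (y ** x).
Proof.
move=> xO yO; apply/eqP; rewrite -addr_eq0; apply/eqP.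
have := odd_sq0 (rpredD xO yO).
by rewrite linearDl /= !linearDr /= !odd_sq0 // add0r addr0.
Qed.

(** The linear system has determinant 3. *)
Lemma double_swap_eq0 (p q : A) : p + q + p = 0 -> q + p + q = 0 -> p = 0 /\ q = 0.
Proof.
have three_neq0 : 3%:R != 0 :> F by move: char_neq3; rewrite inE.
have tripled (u v : A) : u + v + u = 0 -> v + u + v = 0 -> u = 0.
  move=> e1 e2; apply/eqP.
  have uv : u + v = - u by apply/eqP; rewrite -addr_eq0 e1.
  have: (u + v) + (u + v) = u by rewrite -addrA [v + _]addrA e2 addr0.
  rewrite uv => uu; have: 3%:R *: u == 0.
    by rewrite scaler_nat mulrS mulr2n -{1}uu addrACA addNr addr0.
  by rewrite scaler_eq0 (negPf three_neq0).
by move=> e1 e2; split; [apply: tripled e1 e2 | apply: tripled e2 e1].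
Qed.

Lemma odd_alternative i a x : a \in gr i -> x \in gr true ->
  [/\ assoc x x a = 0, assoc x a x = 0 & assoc a x x = 0].
Proof.
move=> ai xO.
have ax := mul_homogeneous ai xO; have xa := mul_homogeneous xO ai.
have r : assoc a x x + (-1) ^+ (i && true) *: assoc x a x = 0 := super_swapl ai xO xO.
have m : assoc x a x + (-1) ^+ (i && true) *: assoc x x a = 0 := super_swapr xO ai xO.
move: r m; rewrite andbT /associator !(odd_sq0 xO) linear0l linear0r.
(* For [a] even, [ax] and [xa] are odd and anticommute with [x]; the unknowns are [(ax)x] and
   [(xa)x]. *)
case: i ai ax xa => ai ax xa /=; rewrite ?expr1 ?expr0 ?scaleN1r ?scale1r; last first.
  rewrite (odd_anticomm xO ax) (odd_anticomm xO xa).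
  rewrite subr0 sub0r !opprK addrA.
  move=> r m; have [] := @double_swap_eq0 (a ** x ** x) (x ** a ** x).
  - by [].
  - exact: m.
  by move=> -> ->; rewrite !(oppr0, addr0).
(* For [a] odd, [a] itself anticommutes with [x]; the unknowns are [(xa)x] and [x(xa)]. *)
rewrite (odd_anticomm ai xO) linearNl linearNr /= !opprK subr0 sub0r opprK.
rewrite opprD addrA => r m.
have [] := @double_swap_eq0 (x ** a ** x) (x ** (x ** a)).
- apply/eqP; rewrite -oppr_eq0 !opprD; apply/eqP; rewrite -[RHS]r.
  by rewrite addrAC.
- by rewrite [_ ** _ + _ ** _]addrC.
by move=> -> ->; rewrite !(oppr0, addr0).
Qed.

Lemma homogeneous_alternative i j a x : a \in gr i -> x \in gr j ->
  [/\ assoc x x a = 0, assoc x a x = 0 & assoc a x x = 0].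
Proof.
case: j => ai xj; first exact: odd_alternative ai xj.
have [l r] := even_alternative xj ai; split=> //.
by have := super_swapr xj ai xj; rewrite l scaler0 addr0.
Qed.

Lemma assoc_swapl i j k x y z : x \in gr i -> y \in gr j -> z \in gr k ->
  exists e : F, assoc x y z = e *: assoc y x z.
Proof.
move=> xi yj zk; exists (- (-1) ^+ (i && j)); apply/eqP.
by rewrite scaleNr -addr_eq0 (super_swapl xi yj zk).
Qed.

Lemma assoc_swapr i j k x y z : x \in gr i -> y \in gr j -> z \in gr k ->
  exists e : F, assoc x y z = e *: assoc x z y.
Proof.
move=> xi yj zk; exists (- (-1) ^+ (j && k)); apply/eqP.
by rewrite scaleNr -addr_eq0 (super_swapr xi yj zk).
Qed.

(** * Annihilation by repeated left and right multiplications *)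

Definition side_mul (left : bool) b a := if left then b ** a else a ** b.

Lemma side_mulDr l b a a' : side_mul l b (a + a') = side_mul l b a + side_mul l b a'.
Proof. by case: l; rewrite /= ?linearDl ?linearDr. Qed.

Lemma side_mulZr l b e a : side_mul l b (e *: a) = e *: side_mul l b a.
Proof. by case: l; rewrite /= ?linearZl_LR ?linearZr_LR. Qed.

Lemma side_mulDl l b b' a : side_mul l (b + b') a = side_mul l b a + side_mul l b' a.
Proof. by case: l; rewrite /= ?linearDl ?linearDr. Qed.

Lemma side_mulZl l e b a : side_mul l (e *: b) a = e *: side_mul l b a.
Proof. by case: l; rewrite /= ?linearZl_LR ?linearZr_LR. Qed.

Lemma side_mul0r l b : side_mul l b 0 = 0.
Proof. by case: l; rewrite /= ?linear0l ?linear0r. Qed.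

Lemma side_mul_homogeneous l i j b a :
  b \in gr i -> a \in gr j -> side_mul l b a \in gr (i (+) j).
Proof. by case: l => bi aj; [|rewrite addbC]; apply: mul_homogeneous. Qed.

(** Nilpotency of the multiplication operators, seen from one element [a]; the recursion peels off
    the innermost multiplication. *)
Fixpoint killed (P : A -> Prop) n a : Prop :=
  if n is n'.+1 then forall l b, P b -> killed P n' (side_mul l b a) else a = 0.

Section Killed.
Implicit Type P : A -> Prop.

Lemma killedD P n a a' : killed P n a -> killed P n a' -> killed P n (a + a').
Proof.
elim: n a a' => [|n IH] a a' /=; first by move=> -> ->; rewrite addr0.
by move=> ka ka' l b Pb; rewrite side_mulDr; apply: IH; [apply: ka | apply: ka'].
Qed.

Lemma killedZ P n e a : killed P n a -> killed P n (e *: a).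
Proof.
elim: n a => [|n IH] a /=; first by move=> ->; rewrite scaler0.
by move=> ka l b Pb; rewrite side_mulZr; apply/IH/ka.
Qed.

Lemma killedB P n a a' : killed P n a -> killed P n a' -> killed P n (a - a').
Proof. by move=> ka ka'; rewrite -scaleN1r; apply/killedD/killedZ. Qed.

(** By linearity in the multiplier. The shape [b + e *: b'] covers both the adjunction of one vector
    and the splitting into even and odd parts. *)
Lemma killed_span P Q n a :
  (forall c, Q c -> exists b e b', [/\ P b, P b' & c = b + e *: b']) ->
  killed P n a -> killed Q n a.
Proof.
move=> QP; elim: n a => //= n IH a ka l c /QP[b [e [b' [Pb Pb' ->]]]].
by rewrite side_mulDl side_mulZl; apply/IH/killedD/killedZ; apply: ka.
Qed.

End Killed.

(** * Graded subalgebras and the elements normalizing them *)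

Definition graded_subalgebra (B : bool -> {vspace A}) :=
  (forall i, (B i <= gr i)%VS) /\
  (forall i j b c, b \in B i -> c \in B j -> b ** c \in B (i (+) j)).

Definition normalizes (B : bool -> {vspace A}) k x :=
  x \in gr k /\ forall l i b, b \in B i -> side_mul l b x \in B (i (+) k).

Section Extension.
Variable B : bool -> {vspace A}.
Hypothesis B_sub : graded_subalgebra B.

Local Notation inB := (homogeneous B).

Lemma sub_gr i b : b \in B i -> b \in gr i.
Proof. by case: B_sub => + _ => /(_ i)/subvP; apply. Qed.

Lemma sub_normalizes k b : b \in B k -> normalizes B k b.
Proof.
move=> bk; split; first exact: sub_gr.
case: B_sub => _ cl [] i c ci; rewrite /side_mul; first exact: cl.
by rewrite addbC; apply: cl.
Qed.

(* All associators of [x, b, a] are proportional, so a multiplication by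
   [b \in B] can be moved past one by [x] up to multiplications by [b ** x]
   and [x ** b], which again lie in [B]. *)
Lemma killed_normalizes n k x l j a : normalizes B k x -> a \in gr j ->
  killed inB n a -> killed inB n (side_mul l x a).
Proof.
move=> [xk xB]; elim: n l j a => [|n IH] l j a aj ka.
  by rewrite ka side_mul0r.
move=> l' b [i bi]; have big := sub_gr bi.
have kB l1 c : inB c -> killed inB n (side_mul l1 c a) by apply: ka.
have inbx l1 : inB (side_mul l1 b x) by exists (i (+) k); apply: xB.
have bx : inB (b ** x) := inbx true; have xb : inB (x ** b) := inbx false.
have kbx := kB true _ bx; have kxb := kB true _ xb; have kxb' := kB false _ xb.
have bB : inB b by exists i.
have IHb l1 l2 : killed inB n (side_mul l1 x (side_mul l2 b a)).
  by apply: IH (side_mul_homogeneous l2 big aj) (kB l2 b bB).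
have kxba : killed inB n (assoc x b a) := killedB kxb (IHb true true).
have kbxa : killed inB n (assoc b x a).
  by have [e ->] := assoc_swapl big xk aj; apply: killedZ.
have kbax : killed inB n (assoc b a x).
  by have [e ->] := assoc_swapr big aj xk; apply: killedZ.
have kxab : killed inB n (assoc x a b).
  by have [e ->] := assoc_swapr xk aj big; apply: killedZ.
have kaxb : killed inB n (assoc a x b).
  by have [e ->] := assoc_swapl aj xk big; apply: killedZ.
(* Up to a killed associator, the outer [b] is either merged with [x] or made to act on [a] before
   [x]. *)
case: l' l => -[] /=.
- by rewrite -[b ** _](subKr (b ** x ** a)); apply: killedB.
- by rewrite -[b ** _](subKr (b ** a ** x)); apply: killedB => //; apply: IHb false true.
- by rewrite -[_ ** b](subrK (x ** (a ** b))); apply: killedD => //; apply: IHb true false.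
- by rewrite -[_ ** b](subrK (a ** (x ** b))); apply: killedD.
Qed.

(** By alternativity, multiplying by [x ** x] is multiplying twice by [x] on the same side. *)
Lemma normalizes_sqr k x : normalizes B k x -> normalizes B false (x ** x).
Proof.
move=> [xk xB]; split=> [|l i b bi].
  by have := mul_homogeneous xk xk; rewrite addbb.
have [e1 _ e2] := homogeneous_alternative (sub_gr bi) xk.
move: e1 e2 => /subr0_eq e1 /subr0_eq e2.
have /= := xB l _ _ (xB l _ _ bi); rewrite -addbA addbb.
by case: l => /=; rewrite ?e1 ?e2.
Qed.

(** Multiply [y] by elements of [B] while the product stays outside [B]. Since [n] multiplications
    give 0, this stops, and the last element normalizes [B]. *)
Lemma exists_normalizes n k y : y \in gr k -> y \notin B k -> killed inB n y ->
  exists j x, normalizes B j x /\ x \notin B j.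
Proof.
elim: n k y => [|n IH] k y yk yB ky; first by rewrite ky mem0v in yB.
have [[l [i [b [bi out]]]]|stays] := classic (exists l i b,
    b \in B i /\ side_mul l b y \notin B (i (+) k)).
  apply: IH out _; first exact: side_mul_homogeneous (sub_gr bi) yk.
  by apply: ky; exists i.
exists k, y; split=> //; split=> // l i b bi; apply/negPn/negP => out.
by apply: stays; exists l, i, b.
Qed.

(** Take the last iterated square before the first one in [B]. *)
Lemma exists_normalizes_sqr n k x : normalizes B k x -> x \notin B k ->
  iter n (fun y => y ** y) x = 0 ->
  exists j y, [/\ normalizes B j y, y \notin B j & y ** y \in B false].
Proof.
elim: n k x => [|n IH] k x nx xB; first by move=> /= x0; rewrite x0 mem0v in xB.
rewrite iterSr => x0; have [sB|sB] := boolP (x ** x \in B false).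
  by exists k, x.
exact: IH (normalizes_sqr nx) sB x0.
Qed.

(** * Adjoining a normalizing element whose square lies in the subalgebra *)

Section Adjoin.
Variables (k : bool) (x : A).
Hypotheses (x_norm : normalizes B k x) (xxB : x ** x \in B false).

Lemma side_sqr l j a : a \in gr j ->
  side_mul l x (side_mul l x a) = side_mul l (x ** x) a.
Proof.
move=> aj; have [/subr0_eq e1 _ /subr0_eq e2] := homogeneous_alternative aj x_norm.1.
by case: l => /=; rewrite ?e1 ?e2.
Qed.

Lemma side_mulC l l' j a : a \in gr j ->
  side_mul l x (side_mul l' x a) = side_mul l' x (side_mul l x a).
Proof.
move=> aj; have [_ /subr0_eq e _] := homogeneous_alternative aj x_norm.1.
by case: l; case: l' => //=; rewrite e.
Qed.

(* A product of three multiplications by [x] contains two on the same side,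
   which amount to one multiplication by [x ** x \in B]. *)
Lemma killed_adjoin n j a : a \in gr j -> killed inB n a ->
  killed (fun b => inB b \/ b = x) (3 * n) a.
Proof.
elim: n j a => [|n IH] j a aj ka; first by rewrite muln0.
(* Every allowed multiplication preserves [N m] ([stable]); one by [B] ([lower]), or two by [x] on
   the same side ([lower2]), decrease [m]. Three multiplications always include such a decrease. *)
pose N m c := homogeneous gr c /\ killed inB m c.
have stable m l b c : inB b \/ b = x -> N m c -> N m (side_mul l b c).
  move=> bBx [[i ci] kc].
  have [i' nb] : exists i', normalizes B i' b.
    case: bBx => [[i' bi']|->]; last by exists k.
    by exists i'; apply: sub_normalizes.
  split; last exact: killed_normalizes nb ci kc.
  by exists (i' (+) i); apply: side_mul_homogeneous ci; case: nb.
have lower m l b c : inB b -> N m.+1 c -> N m (side_mul l b c).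
  move=> bB [hc kc]; split; last exact: kc.
  case: bB hc => i' bi' [i ci]; exists (i' (+) i).
  exact: side_mul_homogeneous (sub_gr bi') ci.
have lower2 l c : N n.+1 c -> N n (side_mul l x (side_mul l x c)).
  move=> Nc; have [[i ci] _] := Nc.
  by rewrite (side_sqr l ci); apply: (lower) => //; exists false.
have Na : N n.+1 a by split; first exists j.
rewrite mulnS => l1 b1 B1 l2 b2 B2 l3 b3 B3.
suff [[i ci] kc] : N n (side_mul l3 b3 (side_mul l2 b2 (side_mul l1 b1 a))).
  exact: IH ci kc.
case: (B1) => [b1B|->]; first by do 2!apply: (stable) => //; apply: (lower).
case: (B2) => [b2B|->].
  by apply: (stable) => //; apply: (lower) => //; apply: (stable) => //; right.
case: (B3) => [b3B|->].
  by apply: (lower) => //; do 2!(apply: (stable); first by right).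
(* All three multiplications are by [x], so two share a side; if these are the first and the third,
   [side_mulC] makes them adjacent. *)
have [->|ne12] := eqVneq l1 l2; first by apply: (stable); [right | apply: (lower2)].
have [->|ne23] := eqVneq l2 l3; first by apply: (lower2); apply: (stable); first right.
have ->: l3 = l1 by case: (l1) (l2) (l3) ne12 ne23 => -[] [].
by rewrite (side_mulC l2 l1 aj); apply: (lower2); apply: (stable); first right.
Qed.

Definition adjoin i := (B i + (if i == k then <[x]> else 0))%VS.

Lemma adjoinP i c : c \in adjoin i ->
  exists b e, [/\ b \in B i, c = b + e *: x & i = k \/ e = 0].
Proof.
case/memv_addP => b bi [d]; case: eqP => [ik|_].
  by case/vlineP => e -> ->; exists b, e; split=> //; left.
by rewrite memv0 => /eqP-> ->; exists b, 0; rewrite scale0r; split=> //; right.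
Qed.

Lemma adjoin_sub i : (B i <= adjoin i)%VS.
Proof. exact: addvSl. Qed.

Lemma adjoin_graded_subalgebra : graded_subalgebra adjoin.
Proof.
split=> [i|i j b c /adjoinP[b' [e [bi -> ie]]] /adjoinP[c' [f [cj -> jf]]]].
  rewrite subv_add (B_sub.1 i); case: eqP => [->|_]; last exact: sub0v.
  by rewrite -memvE; case: x_norm.
apply: (subvP (adjoin_sub _)); rewrite !(linearDl, linearDr) /=.
have [_ xB] := x_norm.
rewrite !(linearZl_LR, linearZr_LR) /=; do !apply: rpredD.
- exact: B_sub.2.
- case: jf => [->|->]; last by rewrite scale0r mem0v.
  by apply/rpredZ/(xB true).
- case: ie => [->|->]; last by rewrite scale0r mem0v.
  by rewrite addbC; apply/rpredZ/(xB false).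
- case: ie => [->|->]; last by rewrite scale0r mem0v.
  case: jf => [->|->]; last by rewrite scale0r scaler0 mem0v.
  by rewrite addbb; do !apply: rpredZ.
Qed.

Lemma killed_adjoin_homogeneous n j a : a \in gr j -> killed inB n a ->
  killed (homogeneous adjoin) (3 * n) a.
Proof.
move=> aj /(killed_adjoin aj); apply: killed_span => c [i /adjoinP[b [e [bi -> _]]]].
by exists b, e, x; split=> //; [left; exists i | right].
Qed.

Lemma dim_adjoin : x \notin B k ->
  (\dim (B false) + \dim (B true) < \dim (adjoin false) + \dim (adjoin true))%N.
Proof.
move=> xB; have lei i : (\dim (B i) <= \dim (adjoin i))%N.
  by rewrite dimvS ?adjoin_sub.
suff lt i : (\dim (B i) < \dim (adjoin i))%N ->
    (\dim (B false) + \dim (B true) < \dim (adjoin false) + \dim (adjoin true))%N.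
  apply: (lt k); rewrite ltn_neqAle lei andbT; apply: contra xB => /eqP e.
  have /eqP-> : B k == adjoin k by rewrite eqEdim adjoin_sub e leqnn.
  by rewrite /adjoin eqxx memvE addvSr.
by case: i => lt; [rewrite -addnS | rewrite -addSn]; apply: leq_add.
Qed.

End Adjoin.
End Extension.

(** * Repeated squaring, and the growth of the subalgebra up to the whole algebra *)

Lemma homogeneous_mul x y :
  homogeneous gr x -> homogeneous gr y -> homogeneous gr (x ** y).
Proof. by move=> [i xi] [j yj]; exists (i (+) j); apply: mul_homogeneous. Qed.

Lemma homogeneous_square_iter n x : homogeneous gr x ->
  homogeneous gr (iter n (fun y => y ** y) x).
Proof. by move=> hx; elim: n => //= n IH; apply: homogeneous_mul. Qed.

(** Right alternativity [(ay)y = a(yy)] turns two right multiplications by a square into one by the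
    next square. *)
Lemma iter_mulr n x a : homogeneous gr x -> homogeneous gr a ->
  iter (2 ^ n) (fun y => y ** x) a = a ** iter n (fun y => y ** y) x.
Proof.
move=> hx; elim: n a => // n IH a ha; have hy := homogeneous_square_iter n hx.
rewrite expnS mul2n -addnn iterD !IH //; last exact: homogeneous_mul.
case: ha hy => i ai [j yj]; have [_ _] := homogeneous_alternative ai yj.
by move/subr0_eq.
Qed.

(** Links the squares of [exists_normalizes_sqr] to the powers defining nilpotency; the predecessor
    appears because [alg_power mul x m] is the power of exponent [m + 1]. *)
Lemma square_iter_power n x : homogeneous gr x ->
  iter n (fun y => y ** y) x = alg_power mul x (2 ^ n).-1.
Proof.
move=> hx; elim: n => //= n IH; have hy := homogeneous_square_iter n hx.
rewrite -iter_mulr // IH /alg_power -iterD; congr iter.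
by rewrite expnS mul2n -addnn; case: (2 ^ n)%N (expn_gt0 2 n) => // m _; rewrite addnS.
Qed.

Hypothesis A_graded_nil : graded_nil mul gr.

Lemma square_iter_nil x : homogeneous gr x ->
  exists n, iter n (fun y => y ** y) x = 0.
Proof.
move=> hx; have [n xn] := A_graded_nil hx; exists n; rewrite square_iter_power //.
have le : (n <= (2 ^ n).-1)%N by rewrite -ltnS prednK ?expn_gt0 // ltn_expl.
rewrite /alg_power -(subnK le) iterD -/(alg_power mul x n) xn.
by elim: (_ - _)%N => //= m ->; rewrite linear0l.
Qed.

Lemma homogeneous_killed_gr :
  exists n, forall a, homogeneous gr a -> killed (homogeneous gr) n a.
Proof.
pose D (B : bool -> {vspace A}) := (\dim (B false) + \dim (B true))%N.
(* [d] strictly bounds the codimension of [B]; each adjunction lowers the bound by one. *)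
suff grow d B n : graded_subalgebra B -> (D gr < D B + d)%N ->
    (forall a, homogeneous gr a -> killed (homogeneous B) n a) ->
    exists m, forall a, homogeneous gr a -> killed (homogeneous gr) m a.
  apply: (grow (D gr).+1 (fun=> 0%VS) 1%N).
  - split=> [i|i j b c]; first exact: sub0v.
    by rewrite !memv0 => /eqP-> _; rewrite linear0l.
  - by rewrite addnS ltnS leq_addl.
  - move=> a _ l b [i]; rewrite memv0 => /eqP->.
    by case: l; rewrite /= ?linear0l ?linear0r.
elim: d B n => [|d IH] B n subB ltD kB.
  move: ltD; rewrite addn0 ltnNge leq_add //; apply: dimvS; apply: subB.1.
have [/forallP full|] := boolP [forall i, (gr i <= B i)%VS].
  exists n => a ha; apply: killed_span (kB a ha) => c [i ci].
  exists c, 0, c; rewrite scale0r addr0.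
  by split=> //; exists i; apply: (subvP (full i)).
case/forallPn => i /subvPn[y yi yB].
have [j [x [nx xB]]] := exists_normalizes subB yi yB (kB y (ex_intro _ i yi)).
have [m xm] := square_iter_nil (ex_intro _ j nx.1).
have [k [z [nz zB zz]]] := exists_normalizes_sqr subB nx xB xm.
apply: (IH (adjoin B k z) (3 * n)%N).
- exact: adjoin_graded_subalgebra.
- by apply: leq_trans ltD _; rewrite addnS -addSn leq_add2r; apply: dim_adjoin.
- move=> a [l al].
  exact (killed_adjoin_homogeneous subB nz zz al (kB a (ex_intro _ l al))).
Qed.

Lemma killed_all : exists n, forall a, killed (fun=> True) n a.
Proof.
have [n kn] := homogeneous_killed_gr; exists n => a.
suff ka : killed (homogeneous gr) n a.
  apply: killed_span ka => c _; have [y [z [yE zO ->]]] := homogeneous_decomp c.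
  by exists y, 1, z; rewrite scale1r; split=> //; [exists false | exists true].
have [y [z [yE zO ->]]] := homogeneous_decomp a.
by apply: killedD; apply: kn; [exists false | exists true].
Qed.

End OddSquareZero.
End AlternativeSuperalgebra.

(** If a product has at least [2 ^ k.+1] leaves, one of its two factors has at least [2 ^ k], and
    the other acts on it as one more multiplication. So [2 ^ k] leaves account for [k] of the [n]
    multiplications. *)
Lemma nilpotent_algebra_killed (F : fieldType) (A : vectType F)
    (mul : {bilinear A -> A -> A}) n :
  (forall a, killed mul (fun=> True) n a) -> nilpotent_algebra mul.
Proof.
move=> kn; exists (2 ^ n)%N; first by rewrite expn_gt0.
suff big k : (k <= n)%N -> forall t : bracketing A, (2 ^ k <= nb_factors t)%N ->
    killed mul (fun=> True) (n - k) (bracketing_eval mul t).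
  by move=> t tn; have := big n (leqnn n) t; rewrite tn subnn; apply.
elim: k => [|k IH] lekn t le; first by rewrite subn0.
have {}IH := IH (ltnW lekn).
case: t le => [x|t1 t2] /=; first by rewrite (@leq_exp2l 2 k.+1 0).
have [le1 _|lt1] := leqP (2 ^ k) (nb_factors t1).
  by have := IH _ le1; rewrite -(subnSK lekn) => /(_ false (bracketing_eval mul t2)); apply.
rewrite expnS mul2n -addnn => le.
have le2 : (2 ^ k <= nb_factors t2)%N.
  by rewrite -(leq_add2l (nb_factors t1)); apply: leq_trans le; rewrite leq_add2r ltnW.
by have := IH _ le2; rewrite -(subnSK lekn) => /(_ true (bracketing_eval mul t1)); apply.
Qed.

Theorem corollary3p6 (F : fieldType) (A : vectType F)
    (mul : {bilinear A -> A -> A}) (gr : bool -> {vspace A})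
    (char_neq3 : 3%N \notin [pchar F])
    (A_alternative : alternative_superalgebra mul gr)
    (A_graded_nil : graded_nil mul gr)
    (odd_sq0 : forall a1 : A, a1 \in gr true -> mul a1 a1 = 0) :
  nilpotent_algebra mul.
Proof.
have [n kn] := killed_all A_alternative char_neq3 odd_sq0 A_graded_nil.
exact: nilpotent_algebra_killed kn.
Qed.
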